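(* Let $\beta,\varkappa$ be scalars and let $U,D_\beta,D_\varkappa$ be the linear operators on the space with basis all partitions given by $$U\lambda=\sum_{\lambda+\square}(\lambda+\square)-\beta\, i(\lambda)\,\lambda,\qquad D_\beta\lambda=\sum_{\mu}\beta^{|\lambda/\mu|-1}\mu,\qquad D_\varkappa\lambda=\sum_{\mu\subsetneq\lambda}\varkappa^{c(\lambda/\mu)}\beta^{|\lambda/\mu|-c(\lambda/\mu)}\mu,$$ where the first sum is over all partitions obtained from $\lambda$ by adding one box, and the sum defining $D_\beta$ is over all partitions $\mu\subsetneq\lambda$ such that all boxes of $\lambda/\mu$ lie in a single column. (These are the up/down operators of the $\beta$-filtration $\beta\mathbb{Y}$ with down operator $D_\beta$, and of the Cauchy filtration $\varkappa\mathbb{Y}$ with down operator $D_\varkappa$, of Young's lattice.) Then (i) $[D_\beta,U]=1$, so $\beta\mathbb{Y}$ is a dual filtered graph; (ii) $[D_\varkappa,U]=\varkappa(1+D_\varkappa)$, so $\varkappa\mathbb{Y}$ is a dual filtered graph.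
   Context: $i(\lambda)$ is the number of removable boxes (inner corners) of $\lambda$; $|\lambda/\mu|$ is the number of boxes of $\lambda/\mu$ and $c(\lambda/\mu)$ its number of nonempty columns. $[D,U]=DU-UD$. A pair of weighted filtered graphs on the same ranked vertex set with up operator $U$ and down operator $D$ is a dual filtered graph if $[D,U]=\alpha+\beta' D$ for some scalars $\alpha,\beta'$. In $\beta\mathbb{Y}$ and $\varkappa\mathbb{Y}$, up edges are $\lambda\to\lambda+\square$ with weight $1$ together with $i(\lambda)$ loops at $\lambda$ of weight $-\beta$. *)

(* Defs.v *)
From HB Require Import structures.
From mathcomp Require Import all_boot all_order all_algebra.
From mathcomp Require Import finmap.
From mathcomp.multinomials Require Import monalg.

Set Implicit Arguments.
Unset Strict Implicit.
Unset Printing Implicit Defensive.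

Import GRing.Theory.
Local Open Scope ring_scope.

(** Partitions and their Young diagrams *)

Definition is_partition (s : seq nat) : bool := sorted geq s && (0 \notin s)%N.

Record intpart := IntPart { parts :> seq nat; _ : is_partition parts }.

HB.instance Definition _ := [isSub for parts].
HB.instance Definition _ := [Countable of intpart by <:].

Definition weight (lam : intpart) : nat := sumn lam.

(* A box is a pair (row, column), both numbered from 0. *)
Definition boxes (lam : intpart) : seq (nat * nat) :=
  [seq (i, j) | i <- iota 0 (size lam), j <- iota 0 (nth 0%N lam i)].

Lemma mem_boxes lam b : (b \in boxes lam) = (b.2 < nth 0 lam b.1)%N.
Proof.
case: b => i j /=; apply/allpairsPdep/idP => [[i' [j' [_]]]|lt_j].
  by rewrite mem_iota => /= h [-> ->].
exists i, j; split=> //; rewrite mem_iota //= add0n.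
by rewrite ltnNge; apply: contraL lt_j => le_i; rewrite nth_default.
Qed.

Lemma size_boxes lam : size (boxes lam) = weight lam.
Proof.
rewrite /boxes size_allpairs_dep /weight; congr sumn.
rewrite -[RHS](mkseq_nth 0%N); apply: eq_map => i.
by rewrite size_iota.
Qed.

Lemma boxes_uniq lam : uniq (boxes lam).
Proof.
apply: allpairs_uniq_dep => [|i _|]; rewrite ?iota_uniq //.
by move=> [a b] [c d] _ _ /= [-> ->].
Qed.

Definition included (mu lam : intpart) : bool :=
  all [in boxes lam] (boxes mu).

Definition strictly_included (mu lam : intpart) : bool :=
  included mu lam && (mu != lam).

Lemma included_weight mu lam : included mu lam -> (weight mu <= weight lam)%N.
Proof.
move/allP => sub; rewrite -!size_boxes.
exact: uniq_leq_size (boxes_uniq _) sub.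
Qed.

Definition skew_boxes (lam mu : intpart) : seq (nat * nat) :=
  [seq b <- boxes lam | b \notin boxes mu].

Definition skew_size (lam mu : intpart) : nat := size (skew_boxes lam mu).

Definition skew_columns (lam mu : intpart) : seq nat :=
  undup [seq b.2 | b <- skew_boxes lam mu].

Definition in_single_column (lam mu : intpart) : bool :=
  constant [seq b.2 | b <- skew_boxes lam mu].

(* mu is obtained from lam by adding one box. *)
Definition adds_box (lam mu : intpart) : bool :=
  included lam mu && (skew_size mu lam == 1%N).

(* A box of lam can be removed iff lam has no box immediately below it and
   none immediately to its right. *)
Definition removable (lam : intpart) (b : nat * nat) : bool :=
  [&& b \in boxes lam, (b.1.+1, b.2) \notin boxes lam
    & (b.1, b.2.+1) \notin boxes lam].

Definition inner_corners (lam : intpart) : nat :=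
  count (removable lam) (boxes lam).

(* The finitely many partitions of weight at most n: the index range of the
   sums over partitions below. *)
Fixpoint bounded_seqs (k n : nat) : seq (seq nat) :=
  if k is k'.+1 then
    [::] :: [seq a :: s | a <- iota 1 n, s <- bounded_seqs k' n]
  else [:: [::]].

Definition partitions_upto (n : nat) : seq intpart :=
  undup [seq mu <- pmap insub (bounded_seqs n n) | (weight mu <= n)%N].

Lemma partitions_upto_uniq n : uniq (partitions_upto n).
Proof. exact: undup_uniq. Qed.

Lemma mem_bounded_seqs k n s :
  (s \in bounded_seqs k n)
  = (size s <= k)%N && all (fun a => (0 < a <= n)%N) s.
Proof.
elim: k s => [|k IHk] [|a s] //=; rewrite in_cons /=.
apply/allpairsP/idP => [[[b t] /= [hb ht [-> ->]]]|].
  move: hb ht; rewrite mem_iota IHk add1n ltnS => -> /andP[sz al].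
  by rewrite ltnS sz al.
case/and3P=> sz ha al; exists (a, s); rewrite /= mem_iota IHk add1n ltnS.
by rewrite ha al -ltnS sz.
Qed.

Lemma mem_partitions_upto n mu :
  (mu \in partitions_upto n) = (weight mu <= n)%N.
Proof.
rewrite mem_undup mem_filter; case: leqP => //= le_n.
rewrite mem_pmap_sub mem_bounded_seqs.
have mu0 : (0 \notin parts mu)%N by case: mu {le_n} => s /= /andP[].
apply/andP; split; last first.
  apply/allP => a a_mu; apply/andP; split.
    by rewrite lt0n; apply/eqP => a0; rewrite -a0 a_mu in mu0.
  apply: leq_trans le_n; rewrite /weight.
  move: (parts mu : seq nat) (a_mu : a \in parts mu) => s.
  elim: s => //= b s IHs; rewrite in_cons.
  case/orP=> [/eqP->|/IHs le_a]; first exact: leq_addr.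
  exact: leq_trans le_a (leq_addl _ _).
apply: leq_trans le_n; rewrite /weight -[val mu]/(parts mu).
elim: (parts mu) mu0 => //= b s IHs; rewrite in_cons negb_or => /andP[b0 /IHs].
by rewrite -add1n; apply: leq_add; rewrite lt0n eq_sym.
Qed.

Lemma adds_box_upto lam mu :
  adds_box lam mu -> mu \in partitions_upto (weight lam).+1.
Proof.
case/andP=> /allP sub /eqP one; rewrite mem_partitions_upto -!size_boxes.
rewrite -(count_predC [in boxes lam] (boxes mu)).
have -> : count (predC [in boxes lam]) (boxes mu) = 1%N.
  by rewrite -one /skew_size size_filter; apply: eq_count.
rewrite addn1 ltnS -size_filter; apply: uniq_leq_size.
  exact: filter_uniq (boxes_uniq _).
by move=> b; rewrite mem_filter => /andP[].
Qed.

(** The free module {malg R[V]} with basis V, and linear extension *)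

Definition lin_ext (R : comNzRingType) (V : choiceType)
    (f : V -> {malg R[V]}) (g : {malg R[V]}) : {malg R[V]} :=
  \sum_(k <- msupp g) g@_k *: f k.

Lemma lin_extw (R : comNzRingType) (V : choiceType) (f : V -> {malg R[V]})
    (g : {malg R[V]}) (d : {fset V}) :
  (msupp g `<=` d)%fset -> lin_ext f g = \sum_(k <- d) g@_k *: f k.
Proof.
move=> sub; apply: big_fset_incl => // k _.
by rewrite -mcoeff_eq0 => /eqP->; rewrite scale0r.
Qed.

Lemma lin_ext_is_linear (R : comNzRingType) (V : choiceType)
    (f : V -> {malg R[V]}) : linear (lin_ext f).
Proof.
move=> a g h; pose d := (msupp g `|` msupp h `|` msupp (a *: g + h))%fset.
have sg : (msupp g `<=` d)%fset by rewrite /d -fsetUA fsubsetUl.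
have sh : (msupp h `<=` d)%fset by rewrite /d fsetUAC fsubsetUr.
rewrite (lin_extw f sg) (lin_extw f sh) (lin_extw f (fsubsetUr _ _ : _ `<=` d)%fset).
rewrite scaler_sumr -big_split; apply: eq_bigr => k _ /=.
by rewrite mcoeffD mcoeffZ scalerDl scalerA.
Qed.

HB.instance Definition _ (R : comNzRingType) (V : choiceType)
    (f : V -> {malg R[V]}) :=
  GRing.isLinear.Build R {malg R[V]} {malg R[V]} *:%R (lin_ext f)
    (lin_ext_is_linear f).

Lemma lin_extU (R : comNzRingType) (V : choiceType) (f : V -> {malg R[V]}) k :
  lin_ext f << k >> = f k.
Proof.
by rewrite (lin_extw f msuppU_le) big_seq_fset1 mcoeffUU scale1r.
Qed.

Definition commutator (M : zmodType) (A B : M -> M) (v : M) : M :=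
  A (B v) - B (A v).

(** Dual filtered graphs *)

(* Multigraphs: [edges x y] lists the weights of the edges x -> y, one entry
   per edge.  Edges may not decrease the rank; loops are allowed. *)
Record filtered_graph (R : comNzRingType) (V : choiceType) (rank : V -> nat) :=
  FilteredGraph {
    edges : V -> V -> seq R;
    edges_rank : forall x y, edges x y != [::] -> (rank x <= rank y)%N
  }.

Definition is_up_operator (R : comNzRingType) (V : choiceType)
    (rank : V -> nat) (G : filtered_graph R rank)
    (U : {linear {malg R[V]} -> {malg R[V]}}) : Prop :=
  forall x y, (U << x >>)@_y = \sum_(w <- edges G x y) w.

Definition is_down_operator (R : comNzRingType) (V : choiceType)
    (rank : V -> nat) (G : filtered_graph R rank)
    (D : {linear {malg R[V]} -> {malg R[V]}}) : Prop :=
  forall x y, (D << y >>)@_x = \sum_(w <- edges G x y) w.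

(* The up edges are those of G1, the down edges those of G2; the two graphs
   determine U and D uniquely. *)
Definition is_dual_filtered_graph (R : comNzRingType) (V : choiceType)
    (rank : V -> nat) (G1 G2 : filtered_graph R rank)
    (U D : {linear {malg R[V]} -> {malg R[V]}}) : Prop :=
  [/\ is_up_operator G1 U, is_down_operator G2 D
    & exists alpha beta' : R, forall v : {malg R[V]},
        commutator D U v = alpha *: v + beta' *: D v].

(** Operators and filtrations of Young's lattice *)

Section Young.
Variables (R : comNzRingType) (beta kappa : R).
Local Notation M := {malg R[intpart]}.

Definition up_op : {linear M -> M} :=
  lin_ext (fun lam =>
    \sum_(mu <- partitions_upto (weight lam).+1 | adds_box lam mu) << mu >>
    - (beta *+ inner_corners lam) *: << lam >>).

Definition beta_weight (lam mu : intpart) : R :=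
  beta ^+ (skew_size lam mu - 1).

Definition beta_down_op : {linear M -> M} :=
  lin_ext (fun lam =>
    \sum_(mu <- partitions_upto (weight lam)
         | strictly_included mu lam && in_single_column lam mu)
       beta_weight lam mu *: << mu >>).

Definition kappa_weight (lam mu : intpart) : R :=
  kappa ^+ size (skew_columns lam mu)
  * beta ^+ (skew_size lam mu - size (skew_columns lam mu)).

Definition kappa_down_op : {linear M -> M} :=
  lin_ext (fun lam =>
    \sum_(mu <- partitions_upto (weight lam) | strictly_included mu lam)
       kappa_weight lam mu *: << mu >>).

Definition up_edges (lam mu : intpart) : seq R :=
  nseq (adds_box lam mu) 1
  ++ (if mu == lam then nseq (inner_corners lam) (- beta) else [::]).

Lemma up_edges_rank lam mu :
  up_edges lam mu != [::] -> (weight lam <= weight mu)%N.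
Proof.
rewrite /up_edges; case: (mu =P lam) => [->//|_]; rewrite cats0.
by case: (boolP (adds_box lam mu)) => // /andP[/included_weight].
Qed.

Definition up_graph : filtered_graph R weight :=
  FilteredGraph up_edges_rank.

Definition beta_down_edges (mu lam : intpart) : seq R :=
  nseq (strictly_included mu lam && in_single_column lam mu)
       (beta_weight lam mu).

Lemma beta_down_edges_rank mu lam :
  beta_down_edges mu lam != [::] -> (weight mu <= weight lam)%N.
Proof.
rewrite /beta_down_edges; case: (boolP (strictly_included mu lam)) => //.
by case/andP=> /included_weight.
Qed.

Definition beta_down_graph : filtered_graph R weight :=
  FilteredGraph beta_down_edges_rank.

Definition kappa_down_edges (mu lam : intpart) : seq R :=
  nseq (strictly_included mu lam) (kappa_weight lam mu).

Lemma kappa_down_edges_rank mu lam :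
  kappa_down_edges mu lam != [::] -> (weight mu <= weight lam)%N.
Proof.
rewrite /kappa_down_edges; case: (boolP (strictly_included mu lam)) => //.
by case/andP=> /included_weight.
Qed.

Definition kappa_down_graph : filtered_graph R weight :=
  FilteredGraph kappa_down_edges_rank.

End Young.

(* Main.v *)
(** Encode a partition by its column lengths. The matrix of [1 + D_kappa] is then
    a product over columns [j] of a kernel in [a_j], [b_j], the column lengths of
    [lam] and [mu]. Adding a box to column [j] of [lam], or removing one from
    column [j] of [mu], has the same effect on that product: if [mu] is contained
    in [lam], it is multiplied by [kappa] when [a_j = b_j] and by [beta]
    otherwise. Hence [[1 + D_kappa, U] = kappa (1 + D_kappa)] reduces to a
    telescoping count of descents over the columns with [a_j = b_j]; if [mu] is
    not contained in [lam], the two sums agree term by term. Since [D_beta] is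
    the coefficient of [kappa] in [D_kappa], part (i) is the linear coefficient
    of part (ii) over [{poly R}] with [kappa := 'X]. *)

Require Import Defs.
From HB Require Import structures.
From mathcomp Require Import all_boot all_order all_algebra.
From mathcomp Require Import finmap ring zify.
From mathcomp.multinomials Require Import monalg.

Set Implicit Arguments.
Unset Strict Implicit.
Unset Printing Implicit Defensive.

Import GRing.Theory.
Local Open Scope ring_scope.

(** * The identity on column lengths *)

Definition update (a : nat -> nat) (j v i : nat) : nat :=
  if i == j then v else a i.

Definition addable (a : nat -> nat) (j : nat) : bool :=
  (j == 0)%N || (a j < a j.-1)%N.

Section ColumnIdentity.
Variables (R : comNzRingType) (beta kappa : R).

(** What one column contributes to the Cauchy weight: [1] if it is empty in the skew shape, one
    [kappa] and a [beta] for each box after the first otherwise. The value [0] records a failure of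
    containment. *)
Definition column_kernel (x y : nat) : R :=
  if (x < y)%N then 0 else if x == y then 1 else kappa * beta ^+ (x - y).-1.

(** Lets a box removed from [mu] be traded for a box added to [lam]. *)
Lemma column_kernel_shift x y : column_kernel x.+1 y.+1 = column_kernel x y.
Proof. by rewrite /column_kernel ltnS eqSS subSS. Qed.

(** The first box makes the column nonempty and costs [kappa]; each later one costs [beta]. *)
Lemma column_kernelS x y : (y <= x)%N ->
  column_kernel x.+1 y
  = (if x == y then kappa else beta) * column_kernel x y.
Proof.
move=> le_yx; rewrite /column_kernel !ltnNge le_yx (leqW le_yx) /=.
rewrite (gtn_eqF (_ : y < x.+1)%N) //.
case: eqP => [->|/eqP ne]; first by rewrite subSnn expr0.
have -> : ((x.+1 - y).-1 = (x - y).-1.+1)%N by lia.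
by rewrite exprS mulrCA.
Qed.

Variable N : nat.

Definition kernel_prod (a b : nat -> nat) : R :=
  \prod_(j < N) column_kernel (a j) (b j).

Lemma kernel_prod_updatel a b v (j : 'I_N) :
  kernel_prod (update a j v) b
  = column_kernel v (b j) * \prod_(i < N | i != j) column_kernel (a i) (b i).
Proof.
rewrite /kernel_prod (bigD1 j) //= /update eqxx; congr (_ * _).
by apply: eq_bigr => i ne; rewrite (inj_eq val_inj) (negbTE ne).
Qed.

Lemma kernel_prod_updater a b v (j : 'I_N) :
  kernel_prod a (update b j v)
  = column_kernel (a j) v * \prod_(i < N | i != j) column_kernel (a i) (b i).
Proof.
rewrite /kernel_prod (bigD1 j) //= /update eqxx; congr (_ * _).
by apply: eq_bigr => i ne; rewrite (inj_eq val_inj) (negbTE ne).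
Qed.

Lemma kernel_prod_eq0 (a b : nat -> nat) (j : 'I_N) : (a j < b j)%N -> kernel_prod a b = 0.
Proof. by move=> lt; rewrite /kernel_prod (bigD1 j) //= /column_kernel lt mul0r. Qed.

Lemma kernel_prod_others_eq0 (a b : nat -> nat) (i j : 'I_N) : i != j -> (a i < b i)%N ->
  \prod_(i < N | i != j) column_kernel (a i) (b i) = 0.
Proof. by move=> ne lt; rewrite (bigD1 i) //= {1}/column_kernel lt mul0r. Qed.

End ColumnIdentity.

(** By induction on [n], comparing columns [n] and [n.+1]: if [a] and [b] agree at both, their
    descents there coincide; if they agree at exactly one, monotonicity and [b <= a] force the
    required strict descent. *)
Lemma descent_telescope (n : nat) (a b : nat -> nat) :
  {homo a : i j / (i <= j)%N >-> (j <= i)%N} ->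
  {homo b : i j / (i <= j)%N >-> (j <= i)%N} ->
  (forall j, j <= n -> b j <= a j)%N ->
  (\sum_(j < n.+1) (addable a j && (a j == b j)) =
   \sum_(j < n) ((b j.+1 < b j) && (a j == b j)) + (a n == b n))%N.
Proof.
move=> ha hb; elim: n => [|n IHn] le_ba.
  by rewrite big_ord1 big_ord0 /addable eqxx.
rewrite big_ord_recr /= IHn => [|j lj]; last by apply: le_ba; lia.
rewrite big_ord_recr /= -!addnA; congr addn.
rewrite /addable /=.
have := ha n n.+1 (leqnSn n); have := hb n n.+1 (leqnSn n).
have := le_ba n (leqnSn n); have := le_ba n.+1 (leqnn _).
move: (a n) (b n) (a n.+1) (b n.+1) => x y z t.
by case: eqP; case: eqP; case: ltnP; case: ltnP; lia.
Qed.

(** A partition has one more outer corner than inner corners, because column 0 is always addable. *)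
Lemma descent_count (n : nat) (a : nat -> nat) :
  (\sum_(j < n.+1) addable a j = 1 + \sum_(j < n) (a j.+1 < a j))%N.
Proof. by rewrite big_ord_recl /addable eqxx. Qed.

(** This is the matrix entry of [[1 + D_kappa, U] = kappa (1 + D_kappa)]. Column [n], empty in both
    shapes, leaves room for a new box. *)
Lemma kernel_prod_commutator (R : comNzRingType) (beta kappa : R) (n : nat)
    (a b : nat -> nat) :
  {homo a : i j / (i <= j)%N >-> (j <= i)%N} ->
  {homo b : i j / (i <= j)%N >-> (j <= i)%N} ->
  a n = 0%N -> b n = 0%N ->
  let K := kernel_prod beta kappa n.+1 in
  \sum_(j < n.+1 | addable a j) K (update a j (a j).+1) b
  - beta *+ (\sum_(j < n) (a j.+1 < a j)) * K a b
  - (\sum_(j < n.+1 | (b j.+1 < b j)%N) K a (update b j (b j).-1)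
     - beta *+ (\sum_(j < n) (b j.+1 < b j)) * K a b)
  = kappa * K a b.
Proof.
move=> ha hb an bn K.
have bSn : b n.+1 = 0%N by have := hb n n.+1 (leqnSn n); lia.
have Kl v j := @kernel_prod_updatel R beta kappa n.+1 a b v j.
have Kr v j := @kernel_prod_updater R beta kappa n.+1 a b v j.
have [/forallP le_ba|] := boolP [forall j : 'I_n.+1, (b j <= a j)%N]; last first.
  rewrite negb_forall => /existsP[k]; rewrite -ltnNge => lt_k.
  rewrite /K (kernel_prod_eq0 beta kappa lt_k) !mulr0 !subr0; apply/eqP.
  rewrite subr_eq0; apply/eqP; rewrite big_mkcond [RHS]big_mkcond.
  apply: eq_bigr => j _; rewrite Kl Kr.
  (* A change in a column other than [k] keeps the zero factor at [k], so only [j = k] matters. *)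
  have [k_eq|ne] := eqVneq k j; last first.
    by rewrite (kernel_prod_others_eq0 beta kappa ne lt_k) !mulr0 !if_same.
  (* Here [b k] is positive, and by the shift both changes give the kernel value at [a k] and
     [(b k).-1]; only the side conditions of the two sums remain to be compared. *)
  rewrite -{j}k_eq; case E : (b k) lt_k => [//|y] le_y.
  rewrite column_kernel_shift /=.
  have [lt|le] := ltnP (a k) y.
    have -> : column_kernel beta kappa (a k) y = 0 by rewrite /column_kernel lt.
    by rewrite mul0r !if_same.
  have eq_y : y = a k by lia.
  set Q := \prod_(_ < _ | _) _.
  (* If [Q] is nonzero, [b i <= a i] for every [i] other than [k]. As [b k] is [a k + 1], the chains
     [a k < b k <= b (k-1) <= a (k-1)] and [b (k+1) <= a (k+1) <= a k < b k] make both side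
     conditions true; the ends [k = 0] and [k = n] are immediate. *)
  have [->|Q0] := eqVneq Q 0; first by rewrite mulr0 !if_same.
  have others i : (i < n.+1)%N -> i != k :> nat -> (b i <= a i)%N.
    move=> lt_i ne; rewrite leqNgt; apply: contraNN Q0 => lt.
    rewrite /Q (@kernel_prod_others_eq0 _ beta kappa _ a b (Ordinal lt_i)) //.
  have lk := ltn_ord k.
  have -> : addable a k.
    rewrite /addable; case: (nat_of_ord k) E others lk eq_y => //= k' E others lk eq_y.
    have := others k'; have := hb k' k'.+1 (leqnSn _); lia.
  suff -> : (b k.+1 < y.+1)%N by [].
  have [->|ne] := eqVneq (nat_of_ord k) n; first by rewrite bSn.
  have := others k.+1; have := ha k k.+1 (leqnSn _); lia.
have le_ba' j : (j <= n)%N -> (b j <= a j)%N.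
  by move=> lj; apply: (le_ba (Ordinal (lj : (j < n.+1)%N))).
pose c j : R := if a j == b j then kappa else beta.
have -> : \sum_(j < n.+1 | addable a j) K (update a j (a j).+1) b
          = \sum_(j < n.+1) (c j *+ addable a j) * K a b.
  rewrite big_mkcond; apply: eq_bigr => j _.
  rewrite /K Kl (column_kernelS beta kappa (le_ba j)) -mulrA -/(c j).
  rewrite [in RHS]/kernel_prod [in RHS](bigD1 j) //=.
  by case: addable; rewrite ?mulr1n ?mulr0n ?mul0r.
have -> : \sum_(j < n.+1 | (b j.+1 < b j)%N) K a (update b j (b j).-1)
          = \sum_(j < n.+1) (c j *+ (b j.+1 < b j)%N) * K a b.
  rewrite big_mkcond; apply: eq_bigr => j _.
  case: ltnP => [lt|_]; last by rewrite mulr0n mul0r.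
  (* The descent makes [b j] positive, so lowering it amounts to raising [a j]. *)
  rewrite /K Kr -column_kernel_shift prednK; last by lia.
  rewrite (column_kernelS beta kappa (le_ba j)) -mulrA -/(c j).
  by rewrite /kernel_prod [in RHS](bigD1 j).
(* Write [c j] as [beta] plus a correction [kappa - beta] on the columns where [a] and [b] agree. *)
have split_c (P : nat -> bool) : \sum_(j < n.+1) c j *+ P j =
    beta *+ (\sum_(j < n.+1) P j)
    + (kappa - beta) *+ (\sum_(j < n.+1) (P j && (a j == b j))).
  rewrite -!sumrMnr -big_split; apply: eq_bigr => j _ /=.
  by rewrite /c; case: (P j); case: eqP => _; rewrite ?mulr0n ?mulr1n /=; ring.
rewrite -!mulr_suml -!mulrBl; congr (_ * _).
(* The [beta] terms cancel against the loops up to one [beta], from column 0; the corrections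
   telescope to one [kappa - beta], since [a n = b n]. Together they give [kappa]. *)
rewrite split_c (split_c (fun j => b j.+1 < b j)%N) descent_count.
rewrite (descent_telescope ha hb le_ba') an bn eqxx.
rewrite [X in _ - (beta *+ X + _ - _)]big_ord_recr /= bn ltn0 addn0.
rewrite [X in _ - (_ + _ *+ X - _)]big_ord_recr /= bn ltn0 addn0.
rewrite !mulrnDr !mulr1n; ring.
Qed.

(** * Column lengths of a partition *)

(** In a non-increasing list the entries exceeding [j] form a prefix. *)
Lemma ltn_count_sorted (s : seq nat) i j : sorted geq s ->
  (i < count (fun x => j < x) s)%N = (j < nth 0 s i)%N.
Proof.
elim: s i => [|x s IHs] i; first by rewrite nth_nil !ltn0.
move=> srt; have srt' := path_sorted srt.
have /allP le_x : all (geq x) s by apply: order_path_min srt => a b c /= *; lia.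
rewrite /=; case: (ltnP j x) => [lt_jx|le_xj].
  by case: i => [|i] /=; rewrite add1n ?lt_jx // ltnS IHs.
have -> : count (fun y => j < y)%N s = 0%N.
  by apply/eqP; rewrite -leqn0 leqNgt -has_count; apply/hasPn => y /le_x /=; lia.
rewrite ltn0; case: i => [|i] /=; first by lia.
have [lt|ge] := ltnP i (size s); last by rewrite nth_default // ltn0.
have /= := le_x _ (mem_nth 0%N lt); lia.
Qed.

(** The conjugate partition, extended by zeros. *)
Definition col_len (lam : intpart) (j : nat) : nat :=
  count (fun x => j < x)%N lam.

Lemma intpart_sorted (lam : intpart) : sorted geq lam.
Proof. by case: lam => s /= /andP[]. Qed.

Lemma intpart_gt0 (lam : intpart) x : x \in parts lam -> (0 < x)%N.
Proof.
case: lam => s /= /andP[_ s0] xs; rewrite lt0n.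
by apply: contraNneq s0 => <-.
Qed.

Lemma ltn_col_len lam i j : (i < col_len lam j)%N = (j < nth 0 lam i)%N.
Proof. exact: ltn_count_sorted (intpart_sorted lam). Qed.

Lemma mem_boxes_col lam b : (b \in boxes lam) = (b.1 < col_len lam b.2)%N.
Proof. by rewrite mem_boxes ltn_col_len. Qed.

Lemma col_len_homo lam : {homo col_len lam : i j / (i <= j)%N >-> (j <= i)%N}.
Proof. by move=> i j le_ij; apply: sub_count => x /=; lia. Qed.

Lemma col_len_eq0 lam j : (weight lam <= j)%N -> col_len lam j = 0%N.
Proof.
move=> le_j; apply/eqP; rewrite -leqn0 leqNgt -has_count; apply/hasPn => x xs.
rewrite -leqNgt; apply: leq_trans le_j; rewrite /weight.
by rewrite sumnE (big_rem x) //= leq_addr.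
Qed.

Lemma eq_from_ltn (m n : nat) : (forall j, (j < m)%N = (j < n)%N) -> m = n.
Proof. by move=> eq_lt; have := eq_lt m; have := eq_lt n; lia. Qed.

Lemma col_len_inj lam mu : col_len lam =1 col_len mu -> lam = mu.
Proof.
move=> eq_col.
have eq_nth i : nth 0%N lam i = nth 0%N mu i.
  by apply: eq_from_ltn => j; rewrite -!ltn_col_len eq_col.
have szE nu i : (i < size (parts nu))%N = (0 < nth 0 nu i)%N.
  have [lt|ge] := ltnP i (size (parts nu)); last by rewrite nth_default.
  by rewrite (intpart_gt0 (mem_nth _ lt)).
apply: val_inj; apply: (@eq_from_nth _ 0%N) => [|i _]; last exact: eq_nth.
by apply: eq_from_ltn => i; rewrite !szE eq_nth.
Qed.

(** Conjugates the first [n] values of [c]. The empty partition is a default value, never reached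
    under the hypotheses of [of_colsK]. *)
Definition of_cols (c : nat -> nat) (n : nat) : intpart :=
  insubd (IntPart (isT : is_partition [::]))
    (mkseq (fun i => count (fun x => i < x)%N (mkseq c n)) (c 0%N)).

Lemma of_colsK c n : {homo c : i j / (i <= j)%N >-> (j <= i)%N} -> c n = 0%N ->
  col_len (of_cols c n) =1 c.
Proof.
move=> hc cn.
have srt : sorted geq (mkseq c n).
  apply: (homo_sorted (e := leq)); last exact: iota_sorted.
  by move=> i j; exact: hc.
have nthc j : nth 0%N (mkseq c n) j = c j.
  have [lt|ge] := ltnP j n; first by rewrite nth_mkseq.
  by rewrite nth_default ?size_mkseq //; have := hc n j ge; lia.
have cntE i j : (j < count (fun x => i < x) (mkseq c n))%N = (i < c j)%N.
  by rewrite ltn_count_sorted // nthc.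
have part : is_partition
    (mkseq (fun i => count (fun x => i < x)%N (mkseq c n)) (c 0%N)).
  apply/andP; split.
    apply: (homo_sorted (e := leq)); last exact: iota_sorted.
    by move=> i j le_ij; apply: sub_count => x /=; lia.
  apply/mapP => -[i]; rewrite mem_iota add0n => /= lt_i0 /esym.
  by have := cntE i 0%N; lia.
move=> j; apply: eq_from_ltn => i.
rewrite ltn_col_len [parts _]val_insubd part.
have [lt|ge] := ltnP i (c 0%N); first by rewrite nth_mkseq.
rewrite nth_default ?size_mkseq // ltn0.
by have := hc 0%N j (leq0n j); lia.
Qed.

(** * Containment, skew shapes and corners in terms of columns *)

Lemma includedP mu lam :
  reflect (forall j, col_len mu j <= col_len lam j)%N (included mu lam).
Proof.
apply: (iffP allP) => [sub j|le b]; last first.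
  by rewrite !mem_boxes_col => /leq_trans; apply.
case E : (col_len mu j) => [//|m].
by have := sub (m, j); rewrite !mem_boxes_col /= E; apply.
Qed.

(** Each column of the skew shape is an interval of rows, empty by truncated subtraction when the
    column of [mu] is the longer one. *)
Lemma skew_boxes_perm lam mu n : (weight lam <= n)%N ->
  perm_eq (skew_boxes lam mu)
    [seq (i, j) | j <- iota 0 n,
                  i <- iota (col_len mu j) (col_len lam j - col_len mu j)].
Proof.
move=> le_n; apply: uniq_perm.
- exact: filter_uniq (boxes_uniq _).
- apply: allpairs_uniq_dep => [|j _|]; rewrite ?iota_uniq //.
  by move=> [a b] [c d] _ _ /= [-> ->].
case=> i j; rewrite mem_filter !mem_boxes_col /=.
apply/idP/allpairsPdep => [lt|[j' [i' [_]]]]; last first.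
  by rewrite mem_iota => ? [-> ->]; lia.
exists j, i; split=> //; rewrite mem_iota; last by lia.
by rewrite add0n /= ltnNge; apply/negP => /(leq_trans le_n) /col_len_eq0; lia.
Qed.

Lemma skew_size_cols lam mu n : (weight lam <= n)%N ->
  skew_size lam mu = (\sum_(j < n) (col_len lam j - col_len mu j))%N.
Proof.
move=> le_n; rewrite /skew_size (perm_size (skew_boxes_perm mu le_n)).
rewrite size_allpairs_dep sumnE big_map -[in LHS](subn0 n) -/(index_iota 0 n).
by rewrite big_mkord; apply: eq_bigr => j _; rewrite size_iota.
Qed.

Lemma mem_skew_columns lam mu j :
  (j \in skew_columns lam mu) = (col_len mu j < col_len lam j)%N.
Proof.
rewrite mem_undup; apply/mapP/idP => [[[i k]]|lt].
  by rewrite mem_filter !mem_boxes_col /= => h ->; lia.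
by exists (col_len mu j, j); rewrite // mem_filter !mem_boxes_col /= ltnn.
Qed.

Lemma size_skew_columns lam mu n : (weight lam <= n)%N ->
  size (skew_columns lam mu) = (\sum_(j < n) (col_len mu j < col_len lam j))%N.
Proof.
move=> le_n.
have eq : perm_eq (skew_columns lam mu)
    [seq j <- iota 0 n | (col_len mu j < col_len lam j)%N].
  apply: uniq_perm; rewrite ?undup_uniq ?filter_uniq ?iota_uniq // => j.
  rewrite mem_skew_columns mem_filter mem_iota add0n leq0n /=.
  case: (ltnP j n) => [_|/(leq_trans le_n) /col_len_eq0 ->]; last by rewrite ltn0.
  by rewrite andbT.
rewrite (perm_size eq) size_filter -sum1_count -{1}(subn0 n) big_mkord.
by rewrite big_mkcond; apply: eq_bigr => j _; case: ltnP.
Qed.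

(** A removable box is the bottom of its column, and the bottom of column [j] is removable exactly
    when column [j.+1] is strictly shorter. *)
Lemma inner_corners_cols lam n : (weight lam <= n)%N ->
  inner_corners lam = (\sum_(j < n) (col_len lam j.+1 < col_len lam j))%N.
Proof.
move=> le_n.
have eq : perm_eq [seq b <- boxes lam | removable lam b]
    [seq ((col_len lam j).-1, j)
       | j <- [seq j <- iota 0 n | (col_len lam j.+1 < col_len lam j)%N]].
  apply: uniq_perm; first by rewrite filter_uniq ?boxes_uniq.
    by rewrite map_inj_uniq ?filter_uniq ?iota_uniq // => j k [].
  case=> i j; rewrite mem_filter /removable !mem_boxes_col /=.
  apply/idP/mapP => [h|[k]].
    exists j; last by congr pair; lia.
    rewrite mem_filter mem_iota add0n leq0n /=.
    apply/andP; split; first by lia.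
    by rewrite ltnNge; apply/negP => /(leq_trans le_n) /col_len_eq0; lia.
  by rewrite mem_filter => h [-> ->]; lia.
rewrite /inner_corners -size_filter (perm_size eq) size_map size_filter.
rewrite -sum1_count -{1}(subn0 n) big_mkord.
by rewrite big_mkcond; apply: eq_bigr => j _; case: ltnP.
Qed.

(** * Adding or removing a box as a change of one column *)

Lemma adds_boxP lam nu :
  reflect (exists j, col_len nu =1 update (col_len lam) j (col_len lam j).+1)
          (adds_box lam nu).
Proof.
have skE : skew_size nu lam =
    (\sum_(j < weight nu) (col_len nu j - col_len lam j))%N.
  exact: skew_size_cols.
apply: (iffP andP) => [[/includedP le]|[j eq_nu]].
  (* Column differences with sum 1 consist of a single 1, and its index is the column of the new
     box. *)
  rewrite skE => /sum_nat_eq1[j [_ eq1 eq0]].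
  exists j => i; rewrite /update; case: eqP => [->|/eqP ne].
    by have := le j; lia.
  have [lt|ge] := ltnP i (weight nu); last first.
    by have := le i; rewrite (col_len_eq0 ge); lia.
  by have := eq0 (Ordinal lt) ne isT; have := le i; rewrite /=; lia.
split.
  by apply/includedP => i; rewrite eq_nu /update; case: eqP => [->|]; lia.
have lt_j : (j < weight nu)%N.
  by rewrite ltnNge; apply/negP => /col_len_eq0; rewrite eq_nu /update eqxx.
rewrite skE (bigD1 (Ordinal lt_j)) //= eq_nu /update eqxx subSnn big1 // => i.
by rewrite -(inj_eq val_inj) /= eq_nu /update => /negbTE ->; rewrite subnn.
Qed.

Lemma update_inj (a v : nat -> nat) j k : v j != a j ->
  update a j (v j) =1 update a k (v k) -> j = k.
Proof.
move=> ne /(_ j); rewrite /update eqxx; case: eqP => // _ eq_vj.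
by rewrite eq_vj eqxx in ne.
Qed.

(** The added column determines the larger partition, and conversely [of_cols] builds one from each
    addable column. *)
Lemma sum_adds_box (A : nmodType) (lam : intpart) (n m : nat)
    (f : intpart -> A) (g : nat -> A) :
  (weight lam <= n)%N -> (weight lam < m)%N ->
  (forall j nu, col_len nu =1 update (col_len lam) j (col_len lam j).+1 ->
     f nu = g j) ->
  \sum_(nu <- partitions_upto m | adds_box lam nu) f nu
  = \sum_(j < n.+1 | addable (col_len lam) j) g j.
Proof.
move=> le_n lt_m fg; set a := col_len lam.
pose h j := of_cols (update a j (a j).+1) n.+1.
have hK j : (j <= n)%N -> addable a j -> col_len (h j) =1 update a j (a j).+1.
  move=> le_j add_j; apply: of_colsK => [i k le_ik|]; last first.
    by rewrite /update gtn_eqF ?ltnS //; apply: col_len_eq0; lia.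
  have := col_len_homo lam le_ik; rewrite -/a /update.
  case: eqP => [eq_k|_]; case: eqP => [eq_i|ne_i]; rewrite ?eq_i ?eq_k; try lia.
  (* Monotonicity is at risk only between the raised column [j] and an earlier one; addability
     settles this. *)
  move=> _; move: add_j; rewrite /addable.
  have := @col_len_homo lam i j.-1; rewrite -/a; lia.
have eq : perm_eq [seq nu <- partitions_upto m | adds_box lam nu]
    [seq h j | j <- [seq j <- iota 0 n.+1 | addable a j]].
  apply: uniq_perm; first by rewrite filter_uniq ?partitions_upto_uniq.
    rewrite map_inj_in_uniq ?filter_uniq ?iota_uniq // => j k.
    rewrite !mem_filter !mem_iota !add0n /= !ltnS => /andP[aj lj] /andP[ak lk] hjk.
    apply: (@update_inj a (fun j => (a j).+1)) => [|i]; first by lia.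
    by rewrite -hK // -hK // hjk.
  move=> nu; rewrite mem_filter; apply/andP/mapP => [[/adds_boxP[j nuE] _]|].
    have add_j : addable a j.
      rewrite /addable; case: j nuE => //= j nuE.
      have := col_len_homo nu (leqnSn j); rewrite !nuE /update eqxx.
      by rewrite ltn_eqF.
    have le_j : (j <= n)%N.
      rewrite leqNgt; apply/negP => lt_nj; move: add_j; rewrite /addable.
      (* Past column [n] the preceding column is already empty, so no box fits. *)
      have aj : a j.-1 = 0%N by apply: col_len_eq0; lia.
      by rewrite aj; lia.
    exists j; first by rewrite mem_filter mem_iota add_j; lia.
    by apply: col_len_inj => i; rewrite hK.
  case=> j; rewrite mem_filter mem_iota => /andP[add_j lj] ->.
  have ab : adds_box lam (h j) by apply/adds_boxP; exists j; apply: hK; lia.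
  split=> //; have := adds_box_upto ab; rewrite !mem_partitions_upto; lia.
rewrite -big_filter (perm_big _ eq) big_map big_filter.
rewrite -[iota 0 n.+1]/(index_iota 0 n.+1) big_mkord.
by apply: eq_bigr => j add_j; apply/fg/hK => //; rewrite -ltnS.
Qed.

Lemma sum_removes_box (A : nmodType) (mu : intpart) (n m : nat)
    (f : intpart -> A) (g : nat -> A) :
  (weight mu <= n)%N -> (weight mu <= m)%N ->
  (forall j nu, col_len nu =1 update (col_len mu) j (col_len mu j).-1 ->
     f nu = g j) ->
  \sum_(nu <- partitions_upto m | adds_box nu mu) f nu
  = \sum_(j < n.+1 | (col_len mu j.+1 < col_len mu j)%N) g j.
Proof.
move=> le_n le_m fg; set b := col_len mu.
pose h j := of_cols (update b j (b j).-1) n.+1.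
have hK j : (b j.+1 < b j)%N -> col_len (h j) =1 update b j (b j).-1.
  move=> rem_j; apply: of_colsK => [i k le_ik|]; last first.
    have : b n.+1 = 0%N by apply: col_len_eq0; lia.
    by rewrite /update; case: eqP => [->|]; lia.
  have := col_len_homo mu le_ik; rewrite -/b /update.
  case: eqP => [eq_k|ne_k]; case: eqP => [eq_i|_]; rewrite ?eq_i ?eq_k; try lia.
  (* Only a later column could exceed the lowered one; the strict descent at [j] excludes this. *)
  move=> _; have := @col_len_homo mu j.+1 k; rewrite -/b; lia.
have addsE nu j : (0 < b j)%N -> col_len nu =1 update b j (b j).-1 ->
    b =1 update (col_len nu) j (col_len nu j).+1.
  move=> bj nuE i; rewrite /update !nuE /update eqxx.
  by case: eqP => // ->; rewrite prednK.
have eq : perm_eq [seq nu <- partitions_upto m | adds_box nu mu]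
    [seq h j | j <- [seq j <- iota 0 n.+1 | (b j.+1 < b j)%N]].
  apply: uniq_perm; first by rewrite filter_uniq ?partitions_upto_uniq.
    rewrite map_inj_in_uniq ?filter_uniq ?iota_uniq // => j k.
    rewrite !mem_filter => /andP[rj _] /andP[rk _] hjk.
    apply: (@update_inj b (fun j => (b j).-1)) => [|i]; first by lia.
    by rewrite -hK // -hK // hjk.
  move=> nu; rewrite mem_filter; apply/andP/mapP => [[/adds_boxP[j muE] _]|].
    have rem_j : (b j.+1 < b j)%N.
      rewrite /b !muE /update eqxx gtn_eqF // ltnS.
      exact: col_len_homo.
    have lt_j : (j < n)%N.
      rewrite ltnNge; apply/negP => ge_j.
      have : b j = 0%N by apply: col_len_eq0; lia.
      lia.
    exists j; first by rewrite mem_filter mem_iota rem_j; lia.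
    apply: col_len_inj => i; rewrite hK // /update /b !muE /update eqxx.
    by case: eqP => // ->.
  case=> j; rewrite mem_filter mem_iota => /andP[rem_j lj] ->.
  have ab : adds_box (h j) mu.
    by apply/adds_boxP; exists j; apply: addsE (hK _ _) => //; lia.
  split=> //; rewrite mem_partitions_upto.
  by have /andP[/included_weight] := ab; lia.
rewrite -big_filter (perm_big _ eq) big_map big_filter.
rewrite -[iota 0 n.+1]/(index_iota 0 n.+1) big_mkord.
by apply: eq_bigr => j rem_j; apply/fg/hK.
Qed.

(** * The matrix of [1 + D_kappa] as a product over columns *)

Section CauchyKernel.
Variables (R : comNzRingType) (beta kappa : R).

(** Allowing [mu = lam], where the weight is 1, adds the identity to [D_kappa]. *)
Definition cauchy_kernel (lam mu : intpart) : R :=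
  if included mu lam then kappa_weight beta kappa lam mu else 0.

Lemma cauchy_kernel_cols lam mu n : (weight lam <= n)%N -> (weight mu <= n)%N ->
  cauchy_kernel lam mu = kernel_prod beta kappa n (col_len lam) (col_len mu).
Proof.
move=> lam_n mu_n; rewrite /cauchy_kernel; case: includedP => [le|nle]; last first.
  (* Beyond column [n] the columns of [mu] are empty, so a failure of containment shows among the
     first [n]. *)
  have [/forallP le|] :=
      boolP [forall j : 'I_n, (col_len mu j <= col_len lam j)%N].
    case: nle => j; have [lt|ge] := ltnP j n; first exact: (le (Ordinal lt)).
    by rewrite [col_len mu j]col_len_eq0 //; lia.
  rewrite negb_forall => /existsP[k]; rewrite -ltnNge => lt_k.
  by rewrite (kernel_prod_eq0 beta kappa lt_k).
rewrite /kappa_weight (skew_size_cols mu lam_n) (size_skew_columns mu lam_n).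
(* A nonempty column has at least one box, so the truncated subtraction can be done column by
   column. *)
rewrite -sumnB => [|j _]; last by lia.
rewrite !expr_sum -big_split; apply: eq_bigr => j _ /=.
have := le j; rewrite /column_kernel; move: (col_len mu j) (col_len lam j) => y x.
case: ltngtP => //= [lt _|-> _]; last by rewrite subnn expr0 mulr1.
by rewrite expr1 subn1.
Qed.

Lemma cauchy_kernel_commutator lam mu m :
  (weight lam < m)%N -> (weight mu <= m)%N ->
  \sum_(nu <- partitions_upto m | adds_box lam nu) cauchy_kernel nu mu
  - beta *+ inner_corners lam * cauchy_kernel lam mu
  - (\sum_(nu <- partitions_upto m | adds_box nu mu) cauchy_kernel lam nu
     - beta *+ inner_corners mu * cauchy_kernel lam mu)
  = kappa * cauchy_kernel lam mu.
Proof.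
move=> lam_m mu_m; pose n := (weight lam + weight mu)%N.
have lam_n : (weight lam <= n)%N by rewrite /n; lia.
have mu_n : (weight mu <= n)%N by rewrite /n; lia.
have KE := @kernel_prod_commutator R beta kappa n _ _ (@col_len_homo lam)
   (@col_len_homo mu) (col_len_eq0 lam_n) (col_len_eq0 mu_n).
rewrite (inner_corners_cols lam_n) (inner_corners_cols mu_n).
rewrite (@cauchy_kernel_cols lam mu n.+1) ?leqW // -{}KE.
congr (_ - _ - (_ - _)).
  apply: (sum_adds_box (g := fun j => kernel_prod beta kappa n.+1
    (update (col_len lam) j (col_len lam j).+1) (col_len mu))) => // j nu nuE.
  have /adds_box_upto : adds_box lam nu by apply/adds_boxP; exists j.
  rewrite mem_partitions_upto => nu_w; rewrite (@cauchy_kernel_cols _ _ n.+1); try lia.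
  by apply: eq_bigr => i _; rewrite nuE.
apply: (sum_removes_box (g := fun j => kernel_prod beta kappa n.+1
  (col_len lam) (update (col_len mu) j (col_len mu j).-1))) => // j nu nuE.
have /included_weight nu_w : included nu mu.
  by apply/includedP => i; rewrite nuE /update; case: eqP => [->|_]; lia.
rewrite (@cauchy_kernel_cols _ _ n.+1); try lia.
by apply: eq_bigr => i _; rewrite nuE.
Qed.
End CauchyKernel.

(** * The operators *)

Lemma sum_partitions_widen (A : nmodType) (f : intpart -> A) m n :
  (m <= n)%N -> (forall nu, (m < weight nu)%N -> f nu = 0) ->
  \sum_(nu <- partitions_upto m) f nu = \sum_(nu <- partitions_upto n) f nu.
Proof.
move=> le_mn f0.
have eq : perm_eq (partitions_upto m)
    [seq nu <- partitions_upto n | (weight nu <= m)%N].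
  apply: uniq_perm; rewrite ?filter_uniq ?partitions_upto_uniq // => nu.
  by rewrite mem_filter !mem_partitions_upto; lia.
rewrite (perm_big _ eq) big_filter big_mkcond; apply: eq_bigr => nu _.
by case: leqP => // /f0.
Qed.

Lemma sum_delta (R : nzRingType) (T : eqType) (r : seq T) (f : T -> R) x :
  uniq r -> \sum_(y <- r) f y * (y == x)%:R = if x \in r then f x else 0.
Proof.
move=> ur; case: ifP => [xr|/negP nxr].
  rewrite (big_rem x) //= eqxx mulr1 big_seq big1 ?addr0 // => y.
  by rewrite mem_rem_uniq // inE => /andP[/negbTE -> _]; rewrite mulr0.
rewrite big_seq big1 // => y yr; case: eqP => [eq_yx|]; last by rewrite mulr0.
by case: nxr; rewrite -eq_yx.
Qed.

Lemma commutator_basis (R : comNzRingType) (V : choiceType)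
    (A B C : {linear {malg R[V]} -> {malg R[V]}}) :
  (forall k, commutator A B << k >> = C << k >>) ->
  forall v, commutator A B v = C v.
Proof.
move=> eq_k v; rewrite [v]monalgE /commutator !linear_sum -big_split /=.
apply: eq_bigr => k _.
have -> : << v@_k *g k >> = v@_k *: << k >> :> {malg R[V]}.
  by apply/malgP => k'; rewrite mcoeffZ !mcoeffU mulrnAr mulr1.
by rewrite !linearZ /= -scalerDr -eq_k.
Qed.

Section Operators.
Variables (R : comNzRingType) (beta : R).
Local Notation M := {malg R[intpart]}.

Lemma up_op_coeff lam mu :
  (up_op beta << lam >>)@_mu
  = (adds_box lam mu)%:R - beta *+ inner_corners lam * (lam == mu)%:R.
Proof.
rewrite [up_op beta _]lin_extU mcoeffB mcoeffZ mcoeffU; congr (_ - _).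
rewrite raddf_sum big_mkcond /=.
transitivity (\sum_(nu <- partitions_upto (weight lam).+1)
    (adds_box lam nu)%:R * (nu == mu)%:R : R).
  apply: eq_bigr => nu _; rewrite mcoeffU.
  by case: adds_box; rewrite ?mul1r ?mul0r.
rewrite sum_delta ?partitions_upto_uniq //; case: ifP => // /negP nin.
by case: (boolP (adds_box lam mu)) => // /adds_box_upto /nin.
Qed.

Variables (W : intpart -> intpart -> R) (D : {linear M -> M}).
Hypothesis DW : forall lam mu, (D << lam >>)@_mu = W lam mu.
Hypothesis W0 : forall lam mu, (weight lam < weight mu)%N -> W lam mu = 0.

Lemma op_expand lam :
  D << lam >> = \sum_(nu <- partitions_upto (weight lam)) W lam nu *: << nu >>.
Proof.
apply/malgP => mu; rewrite DW raddf_sum /=.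
under eq_bigr do rewrite mcoeffZ mcoeffU.
rewrite sum_delta ?partitions_upto_uniq // mem_partitions_upto.
by case: leqP => // /W0.
Qed.

(** Stated for any down operator with matrix [W], so that it serves both [D_beta] and [1 + D_kappa].
    The bound [m] gives all the sums a common range. *)
Lemma commutator_up_coeff lam mu m :
  (weight lam < m)%N -> (weight mu <= m)%N ->
  (commutator D (up_op beta) << lam >>)@_mu =
  \sum_(nu <- partitions_upto m | adds_box lam nu) W nu mu
  - beta *+ inner_corners lam * W lam mu
  - (\sum_(nu <- partitions_upto m | adds_box nu mu) W lam nu
     - beta *+ inner_corners mu * W lam mu).
Proof.
move=> lam_m mu_m; rewrite /commutator mcoeffB; congr (_ - _).
  rewrite [up_op beta _]lin_extU linearB linearZ linear_sum mcoeffB mcoeffZ raddf_sum /= DW.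
  congr (_ - _); rewrite big_mkcond [RHS]big_mkcond /=.
  under eq_bigr do rewrite DW.
  apply: sum_partitions_widen => // nu lt; case: ifP => // /adds_box_upto.
  by rewrite mem_partitions_upto; lia.
rewrite op_expand linear_sum raddf_sum /=.
under eq_bigr do rewrite linearZ mcoeffZ up_op_coeff.
rewrite (@sum_partitions_widen _ _ _ m); last first.
- by move=> nu /W0 ->; rewrite mul0r.
- exact: ltnW.
under [LHS]eq_bigr do rewrite mulrBr mulrA.
rewrite sumrB sum_delta ?partitions_upto_uniq // mem_partitions_upto mu_m.
congr (_ - _); last by rewrite mulrC.
rewrite [RHS]big_mkcond; apply: eq_bigr => nu _.
by case: adds_box; rewrite ?mulr1 ?mulr0.
Qed.

End Operators.

(** * Low coefficients of the kernel with [kappa := 'X] *)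

Lemma skew_boxes_self lam : skew_boxes lam lam = [::].
Proof.
by apply/eqP; rewrite -size_eq0 size_filter -leqn0 leqNgt -has_count;
   apply/hasPn => b ->.
Qed.

Lemma included_refl lam : included lam lam.
Proof. by apply/includedP. Qed.

Lemma cauchy_kernel_refl (R : comNzRingType) (beta kappa : R) lam :
  cauchy_kernel beta kappa lam lam = 1.
Proof.
rewrite /cauchy_kernel included_refl /kappa_weight /skew_size /skew_columns.
by rewrite skew_boxes_self !expr0 mulr1.
Qed.

Lemma skew_columns_eq0 lam mu :
  included mu lam -> skew_columns lam mu = [::] -> mu = lam.
Proof.
move=> /includedP le nil; apply: col_len_inj => j.
by have := mem_skew_columns lam mu j; rewrite nil in_nil; have := le j; lia.
Qed.

Lemma in_single_columnE lam mu :
  in_single_column lam mu = (size (skew_columns lam mu) <= 1)%N.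
Proof.
rewrite /in_single_column /skew_columns; move: [seq _ | _ <- _] => s.
apply/idP/idP => [|sz].
  case: s => [//|x s] /all_pred1P sE.
  apply: (@uniq_leq_size _ _ [:: x]); first exact: undup_uniq.
  by move=> y; rewrite mem_undup sE !inE => /orP[//|/nseqP[->]].
case: s sz => [//|x s] sz; apply/allP => y ys /=; apply/eqP.
have : x \in undup (x :: s) by rewrite mem_undup mem_head.
have : y \in undup (x :: s) by rewrite mem_undup inE ys orbT.
by case: (undup _) sz => [//|z [|//]] _; rewrite !inE => /eqP -> /eqP ->.
Qed.

(** The kernel is a scalar times ['X] to the number of nonempty columns, which is zero only for the
    empty skew shape. *)
Lemma cauchy_kernel_coef0 (R : comNzRingType) (beta : R) lam mu :
  (cauchy_kernel beta%:P 'X lam mu)`_0 = (lam == mu)%:R.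
Proof.
case: eqP => [->|ne]; first by rewrite cauchy_kernel_refl coef1.
rewrite /cauchy_kernel; case: ifP => [inc|_]; last by rewrite coef0.
rewrite /kappa_weight -polyC_exp coefMC coefXn.
case E : (skew_columns lam mu) => [|x s]; last by rewrite mul0r.
by case: ne; rewrite (skew_columns_eq0 inc E).
Qed.

(** Degree one means exactly one nonempty column, and the exponent of [beta] is then the size minus
    1. *)
Lemma cauchy_kernel_coef1 (R : comNzRingType) (beta : R) lam mu :
  (cauchy_kernel beta%:P 'X lam mu)`_1
  = if strictly_included mu lam && in_single_column lam mu
    then beta_weight beta lam mu else 0.
Proof.
rewrite /strictly_included; case: eqVneq => [->|ne].
  by rewrite cauchy_kernel_refl coef1 andbF.
rewrite /cauchy_kernel andbT; case: ifP => [inc|_]; last by rewrite coef0.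
rewrite in_single_columnE /beta_weight /kappa_weight -polyC_exp coefMC coefXn.
case E : (skew_columns lam mu) => [|x [|y s]]; last by rewrite mul0r.
  by rewrite (skew_columns_eq0 inc E) eqxx in ne.
by rewrite mul1r.
Qed.

(** Take the coefficient of ['X] in [cauchy_kernel_commutator]: on the right, the factor ['X] leaves
    the constant coefficient of the kernel, the identity matrix. *)
Lemma beta_kernel_commutator (R : comNzRingType) (beta : R) lam mu m :
  let W lam mu := (cauchy_kernel beta%:P 'X lam mu)`_1 in
  (weight lam < m)%N -> (weight mu <= m)%N ->
  \sum_(nu <- partitions_upto m | adds_box lam nu) W nu mu
  - beta *+ inner_corners lam * W lam mu
  - (\sum_(nu <- partitions_upto m | adds_box nu mu) W lam nu
     - beta *+ inner_corners mu * W lam mu)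
  = (lam == mu)%:R.
Proof.
move=> W lam_m mu_m.
have := cauchy_kernel_commutator beta%:P 'X lam_m mu_m.
move/(congr1 (fun p : {poly R} => p`_1)).
by rewrite coefXM cauchy_kernel_coef0 !coefB !coef_sum -!polyCMn !coefCM.
Qed.

(** * Matrices of the down operators and the commutation relations *)

Lemma coeff_basis_sum (R : comNzRingType) (P : pred intpart)
    (w : intpart -> R) n mu :
  (forall nu, P nu -> weight nu <= n)%N ->
  (\sum_(nu <- partitions_upto n | P nu) w nu *: << nu >> : {malg R[intpart]})@_mu
  = if P mu then w mu else 0.
Proof.
move=> P_n; rewrite raddf_sum big_mkcond /=.
transitivity (\sum_(nu <- partitions_upto n)
    (if P nu then w nu else 0) * (nu == mu)%:R : R).
  apply: eq_bigr => nu _; case: (P nu); last by rewrite mul0r.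
  by rewrite mcoeffZ mcoeffU.
rewrite sum_delta ?partitions_upto_uniq // mem_partitions_upto.
by case: leqP => // lt; case: ifP => // /P_n; rewrite leqNgt lt.
Qed.

Lemma beta_down_op_coeff (R : comNzRingType) (beta : R) lam mu :
  (beta_down_op beta << lam >>)@_mu
  = if strictly_included mu lam && in_single_column lam mu
    then beta_weight beta lam mu else 0.
Proof.
rewrite [beta_down_op beta _]lin_extU.
by apply: coeff_basis_sum => nu /andP[/andP[/included_weight]].
Qed.

Lemma kappa_down_op_coeff (R : comNzRingType) (beta kappa : R) lam mu :
  (kappa_down_op beta kappa << lam >>)@_mu
  = if strictly_included mu lam then kappa_weight beta kappa lam mu else 0.
Proof.
rewrite [kappa_down_op beta kappa _]lin_extU.
by apply: coeff_basis_sum => nu /andP[/included_weight].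
Qed.

Lemma cauchy_kernel_weight (R : comNzRingType) (beta kappa : R) lam mu :
  (weight lam < weight mu)%N -> cauchy_kernel beta kappa lam mu = 0.
Proof.
rewrite /cauchy_kernel; case: ifP => // /included_weight; lia.
Qed.

Lemma beta_down_commutator (R : comNzRingType) (beta : R) v :
  commutator (beta_down_op beta) (up_op beta) v = v.
Proof.
apply: (@commutator_basis _ _ _ _ idfun) => lam; apply/malgP => mu.
pose m := (weight lam + weight mu).+1.
rewrite (@commutator_up_coeff _ _
  (fun lam mu => (cauchy_kernel beta%:P 'X lam mu)`_1) _ _ _ _ _ m).
- by rewrite beta_kernel_commutator ?mcoeffU // /m; lia.
- by move=> la nu; rewrite beta_down_op_coeff cauchy_kernel_coef1.
- by move=> la nu lt; rewrite cauchy_kernel_weight ?coef0.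
- by rewrite /m; lia.
- by rewrite /m; lia.
Qed.

(* The identity commutes with [up_op], so [kappa_down_op] may be replaced by
   the operator with the multiplicative kernel. *)
Lemma kappa_down_commutator (R : comNzRingType) (beta kappa : R) v :
  commutator (kappa_down_op beta kappa) (up_op beta) v
  = kappa *: (v + kappa_down_op beta kappa v).
Proof.
set Dk := kappa_down_op beta kappa; set U := up_op beta.
pose D : {linear {malg R[intpart]} -> {malg R[intpart]}} := idfun \+ Dk.
have DK lam mu : (D << lam >>)@_mu = cauchy_kernel beta kappa lam mu.
  rewrite /D /= mcoeffD mcoeffU kappa_down_op_coeff /strictly_included.
  case: eqVneq => [->|ne].
    by rewrite cauchy_kernel_refl andbF addr0.
  by rewrite andbT add0r.
have -> : commutator Dk U v = commutator D U v.
  by rewrite /commutator /D /= linearD opprD addrACA subrr add0r.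
apply: (@commutator_basis _ _ _ _ (kappa \*: D)) => lam; apply/malgP => mu.
pose m := (weight lam + weight mu).+1.
rewrite (@commutator_up_coeff _ _ (cauchy_kernel beta kappa) _ _ _ _ _ m) //.
- by rewrite cauchy_kernel_commutator /= ?mcoeffZ ?DK // /m; lia.
- by move=> la nu lt; rewrite cauchy_kernel_weight.
- by rewrite /m; lia.
- by rewrite /m; lia.
Qed.

(** * The operators as those of the weighted graphs *)

Lemma sum_nseq_bool (R : nmodType) (b : bool) (x : R) :
  \sum_(w <- nseq b x) w = if b then x else 0.
Proof. by case: b; rewrite ?big_seq1 ?big_nil. Qed.

Lemma up_op_is_up (R : comNzRingType) (beta : R) :
  is_up_operator (up_graph beta) (up_op beta).
Proof.
move=> lam mu; rewrite up_op_coeff /= /up_edges big_cat sum_nseq_bool /=.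
congr (_ + _); first by case: adds_box.
rewrite eq_sym; case: eqP => _; last by rewrite mulr0 oppr0 big_nil.
by rewrite mulr1 -mulNrn big_nseq iter_addr_0.
Qed.

Theorem theorem9p4 (R : comNzRingType) (beta kappa : R) :
  let U := up_op beta in
  let Db := beta_down_op beta in
  let Dk := kappa_down_op beta kappa in
  ((forall v : {malg R[intpart]}, commutator Db U v = v) /\
   is_dual_filtered_graph (up_graph beta) (beta_down_graph beta) U Db) /\
  ((forall v : {malg R[intpart]}, commutator Dk U v = kappa *: (v + Dk v)) /\
   is_dual_filtered_graph (up_graph beta) (kappa_down_graph beta kappa) U Dk).
Proof.
move=> U Db Dk; split; split.
- exact: beta_down_commutator.
- split; first exact: up_op_is_up.
  + by move=> mu lam; rewrite beta_down_op_coeff /= sum_nseq_bool.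
  + by exists 1, 0 => v; rewrite beta_down_commutator scale1r scale0r addr0.
- exact: kappa_down_commutator.
- split; first exact: up_op_is_up.
  + by move=> mu lam; rewrite kappa_down_op_coeff /= sum_nseq_bool.
  + by exists kappa, kappa => v; rewrite kappa_down_commutator scalerDr.
Qed.
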